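(* Let $a<b$ be real numbers, let $g:\mathbb{R}\to\mathbb{R}$ be non-decreasing and left continuous, and let $f\in\operatorname{BC}_g([a,b],\mathbb{F})$ be such that for every $t\in D_g\cap[a,b)$ the limit $f(t^+)$ exists. Define $D_{g,f}=\{t\in D_g\cap[a,b):\Delta f(t)\neq0\}$. Assume that for every $t\in D_{g,f}$ there exists $\delta\in(0,b-t)$ such that $f(s)\neq0$ for every $s\in[t,t+\delta)$. If there exists $\alpha\in\mathbb{R}$ such that $$\sum_{t\in D_{g,f}}\Big|\log_\alpha\Big(\lim_{s\to t^+}f(s)\Big)-\log_\alpha f(t)\Big|<\infty,$$ then we can write $f=\varphi\psi$ where $\varphi\in\operatorname{AC}_g([a,b],\mathbb{F})\cap\operatorname{AC}_{g^B}([a,b],\mathbb{F})$, $\psi\in\operatorname{BC}_g([a,b],\mathbb{F})\cap\operatorname{BC}([a,b],\mathbb{F})$ and, for $t\in[a,b]$, $$\varphi(t)=\exp\Big(\sum_{s\in D_{g,f}\cap[a,t)}\Big[\log_\alpha\Big(\lim_{r\to s^+}f(r)\Big)-\log_\alpha f(s)\Big]\Big)=\prod_{s\in D_{g,f}\cap[a,t)}\Big(1+\frac{\Delta f(s)}{f(s)}\Big)=1+\sum_{s\in D_{g,f}\cap[a,t)}\frac{\Delta f(s)}{f(s)}\,\varphi(s).$$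
   Context: $\mathbb{F}$ is $\mathbb{R}$ or $\mathbb{C}$. For a function $u$, $u(t^+)$ is the right-hand limit at $t$ and $\Delta u(t)=u(t^+)-u(t)$; $D_g=\{t\in\mathbb{R}:\Delta g(t)>0\}$. For $\sigma\in\mathbb{R}$, $\arg_\sigma:\mathbb{C}\setminus\{0\}\to[\sigma-\pi,\sigma+\pi)$ is the $\sigma$-branch of the argument ($z=|z|e^{i\arg_\sigma z}$) and $\log_\sigma z=\ln|z|+i\arg_\sigma z$ for $z\in\mathbb{C}\setminus\{0\}$; the summability hypothesis includes that the logarithms appearing in it are defined, i.e. $f(t^+)\ne0$ and $f(t)\neq 0$ for $t\in D_{g,f}$. A function $f:[a,b]\to\mathbb{F}$ is $g$-continuous if for every $t\in[a,b]$ and $\varepsilon>0$ there is $\delta>0$ with $|f(t)-f(s)|<\varepsilon$ for all $s\in[a,b]$ with $|g(t)-g(s)|<\delta$; $\operatorname{BC}_g([a,b],\mathbb{F})$ is the set of bounded $g$-continuous functions on $[a,b]$ and $\operatorname{BC}([a,b],\mathbb{F})$ the set of bounded continuous functions (usual sense). The jump part of $g$ is $g^B(t)=\sum_{s\in[0,t)\cap D_g}\Delta g(s)$ for $t>0$ and $g^B(t)=-\sum_{s\in[t,0)\cap D_g}\Delta g(s)$ for $t\leqslant0$. For a non-decreasing left continuous $k:\mathbb{R}\to\mathbb{R}$, $\operatorname{AC}_k([a,b],\mathbb{F})$ is the set of functions $F:[a,b]\to\mathbb{F}$ such that for every $\varepsilon>0$ there is $\delta>0$ such that for every finite family of pairwise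 disjoint subintervals $\{(c_n,d_n)\}_{n=1}^m$ of $[a,b]$, $\sum_n(k(d_n)-k(c_n))<\delta$ implies $\sum_n|F(d_n)-F(c_n)|<\varepsilon$. *)

(* Defs.v *)
From HB Require Import structures.
From mathcomp Require Import all_boot all_order all_algebra.
From mathcomp Require Import all_classical all_reals all_analysis.
From mathcomp Require Import finmap complex.
From mathcomp.analysis.showcase Require summability.

Set Implicit Arguments.
Unset Strict Implicit.
Unset Printing Implicit Defensive.

Import Order.TTheory GRing.Theory Num.Theory.
Import numFieldNormedType.Exports.

Local Open Scope classical_set_scope.
Local Open Scope ring_scope.
Local Open Scope complex_scope.

Variant scalar_kind := RealScalar | ComplexScalar.

Definition scalar_field (R : realType) (k : scalar_kind) : numFieldType :=
  match k with RealScalar => R | ComplexScalar => R[i] end.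

Definition toC (R : realType) (k : scalar_kind) : scalar_field R k -> R[i] :=
  match k with RealScalar => fun x => x%:C | ComplexScalar => fun z => z end.

(* The library norm on [R[i]] takes its values in [R[i]]; this one is
   real-valued, so that it can be compared with real bounds. *)
Definition modulus (R : realType) (k : scalar_kind) : scalar_field R k -> R :=
  match k with
  | RealScalar => fun x => `|x|
  | ComplexScalar => fun z => Normc.normc z
  end.

Definition cexp (R : realType) (z : R[i]) : R[i] :=
  (expR (complex.Re z))%:C * (cos (complex.Im z) +i* sin (complex.Im z)).

(* Meaningful for [z != 0], in which case the angle exists and is unique. *)
Definition arg_branch (R : realType) (sigma : R) (z : R[i]) : R :=
  xget 0 [set theta : R | sigma - pi <= theta < sigma + pi /\
                          z = (Normc.normc z)%:C * cexp (0 +i* theta)].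

Definition log_branch (R : realType) (sigma : R) (z : R[i]) : R[i] :=
  ln (Normc.normc z) +i* arg_branch sigma z.

(* A jump set need not be enumerable in increasing order (it may be dense), so
   infinite sums and products are limits along the net of finite subsets; for
   sums of real or complex numbers this is absolute convergence. *)
Definition has_sum (T : choiceType) (K : numFieldType) (A : set T) (u : T -> K)
    (l : K) : Prop :=
  (fun X : {fset T} => \sum_(s <- X | s \in A) u s) @ summability.totally --> l.

Definition has_prod (T : choiceType) (K : numFieldType) (A : set T) (u : T -> K)
    (l : K) : Prop :=
  (fun X : {fset T} => \prod_(s <- X | s \in A) u s) @ summability.totally --> l.

(* [lim] is a default value when there is no right-hand limit. *)
Definition rlim (R : realType) (K : numFieldType) (u : R -> K) (t : R) : K :=
  lim (u x @[x --> t^'+]).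

Definition jump (R : realType) (K : numFieldType) (u : R -> K) (t : R) : K :=
  rlim u t - u t.

Definition jump_set (R : realType) (g : R -> R) : set R :=
  [set t | 0 < jump g t].

Definition common_jump_set (R : realType) (K : numFieldType) (a b : R)
    (g : R -> R) (f : R -> K) : set R :=
  [set t | jump_set g t /\ a <= t < b /\ jump f t != 0].

(* For non-decreasing [g] both sums are finite, so [fine] loses nothing. *)
Definition jump_part (R : realType) (g : R -> R) (t : R) : R :=
  if 0 < t then fine (\esum_(s in `[0, t[ `&` jump_set g) (jump g s)%:E)
  else - fine (\esum_(s in `[t, 0[ `&` jump_set g) (jump g s)%:E).

(* Functions on [[a, b]] are represented by functions on [R]; every predicate
   below only looks at their values on [[a, b]]. *)
Definition gcontinuous (R : realType) (k : scalar_kind) (a b : R) (g : R -> R)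
    (f : R -> scalar_field R k) : Prop :=
  forall t : R, a <= t <= b -> forall e : R, 0 < e ->
  exists2 d : R, 0 < d & forall s : R, a <= s <= b ->
    `|g t - g s| < d -> modulus (f t - f s) < e.

Definition BC_wrt (R : realType) (k : scalar_kind) (a b : R) (g : R -> R)
    (f : R -> scalar_field R k) : Prop :=
  [bounded f x | x in `[a, b]] /\ gcontinuous a b g f.

Definition BC_usual (R : realType) (k : scalar_kind) (a b : R)
    (f : R -> scalar_field R k) : Prop :=
  [bounded f x | x in `[a, b]] /\ {within `[a, b], continuous f}.

Definition AC_wrt (R : realType) (k : scalar_kind) (a b : R) (h : R -> R)
    (F : R -> scalar_field R k) : Prop :=
  forall e : R, 0 < e -> exists2 d : R, 0 < d &
  forall (m : nat) (c q : 'I_m -> R),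
    (forall i, a <= c i /\ c i < q i /\ q i <= b) ->
    trivIset setT (fun i => `]c i, q i[%classic) ->
    \sum_(i < m) (h (q i) - h (c i)) < d ->
    \sum_(i < m) modulus (F (q i) - F (c i)) < e.

(* Main.v *)
(* Put [L s = log f(s+) - log f(s)] on the common jump set [D] and let [S t] be
   the sum of [L] over [[a, t[ `&` D].  Summability makes the tails of these sums
   uniformly small, so only finitely many points of [D] matter up to [e]; the
   increments of [g], and those of its jump part, over an interval containing
   such a point are bounded below by the jump of [g] there, and this yields
   absolute continuity of [phi = exp S] with respect to both.  Since
   [exp (L s) = f(s+) / f(s)], [phi] has the same relative jumps as [f], so
   [psi = f / phi] has none; at the points where [g] does not jump,
   [g]-continuity already implies continuity. *)
Require Import Defs.
From HB Require Import structures.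
From mathcomp Require Import all_boot all_order all_algebra.
From mathcomp Require Import all_classical all_reals all_analysis.
From mathcomp Require Import finmap complex ring lra.
From mathcomp.analysis.showcase Require summability.

Set Implicit Arguments.
Unset Strict Implicit.
Unset Printing Implicit Defensive.

Import Order.TTheory GRing.Theory Num.Theory.
Import numFieldNormedType.Exports.

Local Open Scope classical_set_scope.
Local Open Scope ring_scope.
Local Open Scope complex_scope.

Local Notation nc := Normc.normc.

(** * The complex exponential and logarithm *)

Lemma normc_ge0 (R : realType) (z : R[i]) : 0 <= nc z.
Proof. by case: z => x y; exact: sqrtr_ge0. Qed.

Lemma normc_real (R : realType) (x : R) : nc x%:C = `|x|.
Proof. by rewrite /= expr0n addr0 sqrtr_sqr. Qed.

Lemma normc_distC (R : realType) (x y : R[i]) : nc (x - y) = nc (y - x).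
Proof. by rewrite -normcN opprB. Qed.

Lemma normc_sum (R : realType) (I : Type) (r : seq I) (P : pred I)
    (F : I -> R[i]) :
  nc (\sum_(i <- r | P i) F i) <= \sum_(i <- r | P i) nc (F i).
Proof.
apply: (big_ind2 (fun x y => nc x <= y)) => //; first by rewrite Normc.normc0.
by move=> x1 x2 y1 y2 h1 h2; apply: le_trans (le_normcD _ _) _; exact: lerD.
Qed.

Lemma normc_ge_Re (R : realType) (z : R[i]) : `|complex.Re z| <= nc z.
Proof.
case: z => x y /=; rewrite -sqrtr_sqr ler_sqrt ?lerDl ?sqr_ge0 //.
by rewrite addr_ge0 ?sqr_ge0.
Qed.

Lemma normc_ge_Im (R : realType) (z : R[i]) : `|complex.Im z| <= nc z.
Proof.
case: z => x y /=; rewrite -sqrtr_sqr ler_sqrt ?lerDr ?sqr_ge0 //.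
by rewrite addr_ge0 ?sqr_ge0.
Qed.

Lemma normc_le_ReIm (R : realType) (z : R[i]) :
  nc z <= `|complex.Re z| + `|complex.Im z|.
Proof.
have -> : z = (complex.Re z)%:C + (0 +i* complex.Im z).
  by case: z => x y; apply/eqP; rewrite eq_complex /= addr0 add0r !eqxx.
apply: le_trans (le_normcD _ _) _; rewrite normc_real /= addr0 add0r.
by rewrite expr0n /= add0r sqrtr_sqr.
Qed.

Lemma cexpD (R : realType) (x y : R[i]) : cexp (x + y) = cexp x * cexp y.
Proof.
case: x => a b; case: y => c d; apply/eqP; rewrite eq_complex /cexp /=.
by rewrite expRD cosD sinD; apply/andP; split; apply/eqP; ring.
Qed.

Lemma cexp0 (R : realType) : cexp 0 = 1 :> R[i].
Proof.
apply/eqP; rewrite eq_complex /cexp /= expR0 cos0 sin0.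
by apply/andP; split; apply/eqP; ring.
Qed.

Lemma cexp_sum (R : realType) (I : Type) (r : seq I) (P : pred I)
    (F : I -> R[i]) :
  cexp (\sum_(i <- r | P i) F i) = \prod_(i <- r | P i) cexp (F i).
Proof. by apply: big_morph; [exact: cexpD | exact: cexp0]. Qed.

Lemma normc_cexp (R : realType) (z : R[i]) : nc (cexp z) = expR (complex.Re z).
Proof.
rewrite /cexp Normc.normcM normc_real ger0_norm ?expR_ge0 //= cos2Dsin2.
by rewrite sqrtr1 mulr1.
Qed.

Lemma normc_cexp_le (R : realType) (z : R[i]) : nc (cexp z) <= expR (nc z).
Proof.
rewrite normc_cexp ler_expR; exact: le_trans (ler_norm _) (normc_ge_Re _).
Qed.

Lemma cexp_neq0 (R : realType) (z : R[i]) : cexp z != 0.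
Proof.
apply/eqP => z0; have := normc_cexp z; rewrite z0 Normc.normc0 => /esym/eqP.
by rewrite expR_eq0.
Qed.

Lemma cexpN (R : realType) (z : R[i]) : cexp (- z) = (cexp z)^-1.
Proof.
apply: (mulfI (cexp_neq0 z)); rewrite mulfV ?cexp_neq0 //.
by rewrite -cexpD subrr cexp0.
Qed.

Lemma lipschitz_of_derive (R : realType) (f df : R -> R) :
  (forall x, is_derive x (1 : R) f (df x)) -> (forall x, `|df x| <= 1) ->
  forall x y, `|f x - f y| <= `|x - y|.
Proof.
move=> fdf df1.
have fc : continuous f.
  by move=> x; apply/differentiable_continuous/derivable1_diffP; case: (fdf x).
have lt x y : x < y -> `|f x - f y| <= `|x - y|.
  move=> xy.
  have [c _ E] := @MVT R f df x y xy (fun z _ => fdf z)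
    (continuous_subspaceT fc).
  by rewrite distrC E (distrC x) normrM ler_piMl.
move=> x y; have [xy|yx|->] := ltgtP x y; first exact: lt.
  by rewrite distrC (distrC x); exact: lt.
by rewrite !subrr.
Qed.

(** With z = x + iy, e^z - 1 = (e^x - 1) e^(iy) + (e^(iy) - 1). The first term is at most |x| e^|x|,
    and the real and imaginary parts of the second are at most |y|; each of these three bounds is at
    most |z| e^|z|, whence the factor 3. *)
Lemma normc_cexpB1 (R : realType) (z : R[i]) :
  nc (cexp z - 1) <= 3 * nc z * expR (nc z).
Proof.
set x := complex.Re z; set y := complex.Im z.
have -> : cexp z - 1 = (expR x - 1)%:C * (cos y +i* sin y) +
                       ((cos y - 1) +i* sin y).
  apply/eqP; rewrite eq_complex /cexp /= -/x -/y.
  by apply/andP; split; apply/eqP; ring.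
have xn : `|x| <= nc z by exact: normc_ge_Re.
have yn : `|y| <= nc z by exact: normc_ge_Im.
have n0 : 0 <= nc z := normc_ge0 z.
have e1 : 1 <= expR (nc z) by rewrite -expR0 ler_expR.
(* Both signs of [x] reduce to 1 + u <= e^u, taken at u = -x when x is nonnegative and at u = x
   otherwise. *)
have xe : `|expR x - 1| <= `|x| * expR `|x|.
  have [x0|x0] := leP 0 x.
    have : 1 <= expR x by rewrite -expR0 ler_expR.
    move=> ex1; rewrite !ger0_norm ?subr_ge0 //.
    have := expR_ge1Dx (- x); rewrite expRN => h.
    have ep := expR_gt0 x.
    have : expR x * (1 - x) <= 1.
      by rewrite -[leRHS](mulfV (lt0r_neq0 ep)) ler_pM2l.
    by lra.
  have ex1 : expR x <= 1 by rewrite expR_le1 ltW.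
  rewrite (ler0_norm (ltW x0)) distrC ger0_norm ?subr_ge0 //.
  have h := expR_ge1Dx x; apply: (@le_trans _ _ (- x)); first by lra.
  by rewrite ler_peMr ?oppr_ge0 ?(ltW x0) // -expR0 ler_expR oppr_ge0 ltW.
have xe' : `|expR x - 1| <= nc z * expR (nc z).
  by apply: le_trans xe _; rewrite ler_pM // ?expR_ge0 // ler_expR.
have cy : `|cos y - 1| <= nc z.
  apply: le_trans yn; rewrite -cos0 -{2}(subr0 y).
  apply: (@lipschitz_of_derive R _ (fun x => - sin x)) => t.
  by rewrite normrN sin_max.
have sy : `|sin y| <= nc z.
  apply: le_trans yn; rewrite -{1}(subr0 (sin y)) -sin0 -{2}(subr0 y).
  by apply: (@lipschitz_of_derive R _ cos) => t; rewrite cos_max.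
apply: le_trans (le_normcD _ _) _.
have -> : nc ((expR x - 1)%:C * (cos y +i* sin y)) = `|expR x - 1|.
  by rewrite Normc.normcM normc_real /= cos2Dsin2 sqrtr1 mulr1.
have h2 := normc_le_ReIm ((cos y - 1) +i* sin y).
rewrite [complex.Re _]/= [complex.Im _]/= in h2.
have : nc z <= nc z * expR (nc z) by rewrite ler_peMr.
by lra.
Qed.

Lemma periodic_cos_sin_int (R : realType) (x : R) (n : int) :
  (cos (x + 2 * pi * n%:~R) = cos x) * (sin (x + 2 * pi * n%:~R) = sin x).
Proof.
have P (y : R) (m : nat) : (cos (y + 2 * pi * m%:R) = cos y) *
                           (sin (y + 2 * pi * m%:R) = sin y).
  have -> : 2 * pi * m%:R = pi *+ 2 *+ m :> R by rewrite -mulr_natr; ring.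
  by rewrite (periodicn (@cosD2pi R)) (periodicn (@sinD2pi R)).
case: n => m; first exact: P.
rewrite NegzE; set y := x + _.
have -> : x = y + 2 * pi * m.+1%:R by rewrite /y mulrNz; ring.
by rewrite !P.
Qed.

(** The arc cosine of Re z / |z|, with the sign of Im z, is one angle of z; whole turns then bring
    it into the half-open window around [sigma]. *)
Lemma arg_branch_exists (R : realType) (sigma : R) (z : R[i]) : z != 0 ->
  exists theta : R, sigma - pi <= theta < sigma + pi /\
    z = (nc z)%:C * cexp (0 +i* theta).
Proof.
move=> z0; have n0 : 0 < nc z.
  rewrite lt_neqAle normc_ge0 andbT; apply/eqP => /esym/Normc.eq0_normc/eqP.
  exact/negP.
have [t [ct st]] : exists t : R, cos t = complex.Re z / nc z /\
                                 sin t = complex.Im z / nc z.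
  set u := _ / _; set v := _ / _.
  have uv : u ^+ 2 + v ^+ 2 = 1.
    rewrite /u /v !expr_div_n -mulrDl.
    have -> : complex.Re z ^+ 2 + complex.Im z ^+ 2 = nc z ^+ 2.
      by case: (z) => x y /=; rewrite sqr_sqrtr // addr_ge0 ?sqr_ge0.
    by rewrite mulfV // expf_neq0 // gt_eqF.
  have u1 : -1 <= u <= 1.
    rewrite -ler_norml -(@expr_le1 _ 2) ?normr_ge0 //.
    by rewrite real_normK ?num_real // -uv lerDl sqr_ge0.
  have sv : Num.sqrt (1 - u ^+ 2) = `|v|.
    by rewrite -uv addrC addKr sqrtr_sqr.
  have [v0|v0] := leP 0 v.
    exists (acos u); rewrite sin_acos // acosK ?in_itv //=.
    by rewrite sv ger0_norm.
  exists (- acos u); rewrite sinN cosN sin_acos // acosK ?in_itv //=.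
  by rewrite sv ltr0_norm // opprK.
have p0 : 0 < 2 * pi :> R by rewrite mulr_gt0 // pi_gt0.
(* The number of whole turns separating [t] from the window that starts at [sigma - pi]. *)
pose n := Num.floor ((t - (sigma - pi)) / (2 * pi)).
have /andP[n1 n2] : (n%:~R <= (t - (sigma - pi)) / (2 * pi) < (n + 1)%:~R).
  exact: floor_itv.
have := periodic_cos_sin_int t (- n).
set th := t + _ => cs; exists th; split.
  move: n1 n2; rewrite ler_pdivlMr // ltr_pdivrMr // intrD => n1 n2.
  by rewrite /th mulrNz; apply/andP; split; lra.
apply/eqP; rewrite eq_complex /cexp /= expR0 cs.1 cs.2 ct st.
by apply/andP; split; apply/eqP; field; rewrite gt_eqF.
Qed.

Lemma cexp_log_branch (R : realType) (sigma : R) (z : R[i]) : z != 0 ->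
  cexp (log_branch sigma z) = z.
Proof.
move=> z0; have n0 : 0 < nc z.
  rewrite lt_neqAle normc_ge0 andbT; apply/eqP => /esym/Normc.eq0_normc/eqP.
  exact/negP.
have [t ht] := arg_branch_exists sigma z0.
(* The default value of [xget] is ruled out by the existence of an angle [t]. *)
rewrite /log_branch /arg_branch; case: xgetP => [t' _ [_ E]|/(_ t)//].
rewrite [RHS]E /cexp /= lnK ?posrE // expR0.
by apply/eqP; rewrite eq_complex /=; apply/andP; split; apply/eqP; ring.
Qed.

(** * Real and complex scalars *)

Lemma toC_zmod_morphism (R : realType) (k : scalar_kind) :
  zmod_morphism (@toC R k).
Proof. by case: k => x y //=; rewrite rmorphB. Qed.

Lemma toC_monoid_morphism (R : realType) (k : scalar_kind) :
  monoid_morphism (@toC R k).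
Proof. by case: k; split=> //= x y; rewrite rmorphM. Qed.

(** With [toC] a ring morphism, identities and estimates for either kind of scalar can be
    transported to the complex numbers. *)
HB.instance Definition _ (R : realType) (k : scalar_kind) :=
  GRing.isZmodMorphism.Build (scalar_field R k) R[i] (@toC R k)
    (@toC_zmod_morphism R k).
HB.instance Definition _ (R : realType) (k : scalar_kind) :=
  GRing.isMonoidMorphism.Build (scalar_field R k) R[i] (@toC R k)
    (@toC_monoid_morphism R k).

Lemma modulusE (R : realType) (k : scalar_kind) (x : scalar_field R k) :
  modulus x = nc (toC x).
Proof. by case: k x => x //=; rewrite -normc_real. Qed.

Lemma modulus_ge0 (R : realType) (k : scalar_kind) (x : scalar_field R k) :
  0 <= modulus x.
Proof. by rewrite modulusE normc_ge0. Qed.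

Lemma modulus0 (R : realType) (k : scalar_kind) :
  modulus (0 : scalar_field R k) = 0.
Proof. by case: k; [exact: normr0|exact: Normc.normc0]. Qed.

Lemma modulusN (R : realType) (k : scalar_kind) (x : scalar_field R k) :
  modulus (- x) = modulus x.
Proof. by rewrite !modulusE rmorphN normcN. Qed.

Lemma modulusM (R : realType) (k : scalar_kind) (x y : scalar_field R k) :
  modulus (x * y) = modulus x * modulus y.
Proof. by rewrite !modulusE rmorphM Normc.normcM. Qed.

Lemma modulusV (R : realType) (k : scalar_kind) (x : scalar_field R k) :
  modulus x^-1 = (modulus x)^-1.
Proof. by rewrite !modulusE fmorphV Normc.normcV. Qed.

Lemma modulusD_le (R : realType) (k : scalar_kind) (x y : scalar_field R k) :
  modulus (x + y) <= modulus x + modulus y.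
Proof. by rewrite !modulusE rmorphD le_normcD. Qed.

(** In the complex case the radii of the library norm are positive elements of [R[i]], hence have
    zero imaginary part; real radii therefore suffice. *)
Lemma cvg_modulusP (R : realType) (k : scalar_kind) (T : Type)
    (F : set_system T) (FF : Filter F) (u : T -> scalar_field R k)
    (l : scalar_field R k) :
  u @ F --> l <->
  forall e : R, 0 < e -> \forall x \near F, modulus (l - u x) < e.
Proof.
case: k u l => u l; first exact: cvgrPdist_lt.
split => [/cvgrPdist_lt h e e0|h].
  have : 0 < e%:C by rewrite ltcR.
  by move=> /h; apply: filterS => x /=; rewrite ltcR.
apply/cvgrPdist_lt => -[e e']; rewrite ltcE /= => /andP[/eqP-> e0].
by have := h e e0; apply: filterS => x /=; rewrite ltcR.
Qed.

Lemma bounded_modulusP (R : realType) (k : scalar_kind) (A : set R)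
    (u : R -> scalar_field R k) :
  [bounded u x | x in A] <-> exists M : R, forall x, A x -> modulus (u x) <= M.
Proof.
case: k u => u.
  split=> [[M [_ h]]|[M h]].
    by exists (M + 1) => x Ax; apply: (h (M + 1)) => //; rewrite ltrDl.
  by exists M; split; [exact: num_real|move=> y /ltW My x /h /le_trans; apply].
split=> [[M [Mr h]]|[M h]].
  exists (complex.Re (`|M| + 1)) => x Ax.
  have Mb : M < `|M| + 1 by rewrite ltr_pwDr // real_ler_norm.
  have := h _ Mb x Ax; rewrite /= lecE => /andP[_].
  exact.
exists M%:C; split; first by rewrite complex_real.
move=> y My x /h; rewrite -lecR => /le_trans; apply; exact: ltW.
Qed.

(** The real line is closed in the complex plane: a point off it stays at distance at least |Im z|.
    This later brings exponentials of complex logarithms back into the scalar field. *)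
Lemma toC_closed (R : realType) (k : scalar_kind) (z : R[i]) :
  (forall e : R, 0 < e -> exists x : scalar_field R k, nc (z - toC x) < e) ->
  exists x : scalar_field R k, toC x = z.
Proof.
case: k => h; last by exists z.
exists (complex.Re z); apply/eqP; rewrite eq_complex /= eqxx /= eq_sym.
apply: contraT => Im0; have [|x] := h `|complex.Im z|.
  by rewrite normr_gt0.
move=> /(le_lt_trans (normc_ge_Im _)); case: z {h} Im0 => p q /= _.
by rewrite oppr0 addr0 ltxx.
Qed.

(** * Unordered sums *)

(* Declared inside a section of the library, hence not exported by it. *)
#[local] Existing Instance summability.totally_filter.

Lemma near_totally (T : choiceType) (P : {fset T} -> Prop) :
  (\forall X \near summability.totally, P X) <->
  exists X0 : {fset T}, forall X : {fset T}, (X0 `<=` X)%fset -> P X.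
Proof. by split=> [[X0 _ h]|[X0 h]]; exists X0. Qed.

Lemma perm_filter_fset (T : choiceType) (X Y : {fset T}) :
  (X `<=` Y)%fset -> perm_eq [seq s <- Y | s \in X] X.
Proof.
move=> XY; apply: uniq_perm; [exact/filter_uniq/fset_uniq|exact: fset_uniq|].
move=> s; rewrite mem_filter.
by have [/(fsubsetP XY)->|] := boolP (s \in X).
Qed.

Lemma fset_sumB (T : choiceType) (V : zmodType) (P : pred T) (u : T -> V)
    (X Y : {fset T}) : (X `<=` Y)%fset ->
  \sum_(s <- Y | P s) u s - \sum_(s <- X | P s) u s =
  \sum_(s <- Y | P s && (s \notin X)) u s.
Proof.
move=> XY; rewrite (bigID (fun s => s \in X)) /=.
rewrite -(perm_big _ (perm_filter_fset XY)) big_filter_cond /=.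
under [X in _ - X = _]eq_bigl do rewrite andbC.
by rewrite addrAC subrr add0r.
Qed.

Lemma le_fset_sum (R : realType) (T : choiceType) (P Q : pred T) (u v : T -> R)
    (X : {fset T}) : (forall s, 0 <= v s) -> (forall s, P s -> u s <= v s) ->
  {subset P <= Q} ->
  \sum_(s <- X | P s) u s <= \sum_(s <- X | Q s) v s.
Proof.
move=> v0 uv PQ; rewrite big_mkcond [leRHS]big_mkcond; apply: ler_sum => s _.
case: ifPn => Ps; last by case: ifP.
by rewrite (_ : Q s) ?uv //; exact: PQ.
Qed.

Lemma fset_sum_le_esum (R : realType) (T : choiceType) (D : set T) (w : T -> R)
    (X : {fset T}) :
  ((\sum_(s <- X | s \in D) w s)%:E <= \esum_(s in D) (w s)%:E)%E.
Proof.
apply: esum_ge; exists [set` [fset s in X | s \in D]%fset]; first split.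
- exact: finite_fset.
- by move=> s /=; rewrite in_fset !inE => /andP[_ /set_mem].
rewrite fsbig_finite; last exact: finite_fset.
by rewrite set_fsetK sumEFin lee_fin big_fset /=.
Qed.

(** Take for [X0] a finite subset of [D] whose sum is within [e] of the supremum. Adjoining any
    finite set to [X0] cannot exceed the supremum, so at most [e] is carried outside [X0]. *)
Lemma esum_tail (R : realType) (T : choiceType) (D : set T) (w : T -> R)
    (e : R) : (forall s, 0 <= w s) ->
  (\esum_(s in D) (w s)%:E < +oo)%E -> 0 < e ->
  exists X0 : {fset T}, forall X : {fset T},
    \sum_(s <- X | (s \in D) && (s \notin X0)) w s <= e.
Proof.
move=> w0 fin e0.
have Efin : (\esum_(s in D) (w s)%:E)%E \is a fin_num.
  by rewrite ge0_fin_numE // esum_ge0 // => s _; rewrite lee_fin.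
have [_ [A [Af AD] <-]] := ub_ereal_sup_adherent e0 Efin.
rewrite -/(esum _ _) -(fineK Efin) fsumEFin // -EFinD lte_fin.
rewrite fsbig_finite //= => h; exists (fset_set A) => X.
pose Y := (X `|` fset_set A)%fset.
have := fset_sum_le_esum D w Y; rewrite -(fineK Efin) lee_fin => hY.
have AY : (fset_set A `<=` Y)%fset by rewrite fsubsetUr.
have := fset_sumB (fun s => s \in D) w AY.
have -> : \sum_(s <- fset_set A | s \in D) w s = \sum_(s <- fset_set A) w s.
  rewrite big_mkcond; apply: eq_big_seq => s; rewrite in_fset_set //.
  by move=> /set_mem/AD/mem_set ->.
move=> E; apply: (@le_trans _ _
    (\sum_(s <- Y | (s \in D) && (s \notin fset_set A)) w s)).
  by rewrite -subr_ge0 fset_sumB ?fsubsetUl // sumr_ge0.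
by rewrite -E; lra.
Qed.

Lemma has_sumP (R : realType) (k : scalar_kind) (T : choiceType) (A : set T)
    (u : T -> scalar_field R k) (l : scalar_field R k) :
  has_sum A u l <-> forall e : R, 0 < e -> exists X0 : {fset T},
    forall X : {fset T}, (X0 `<=` X)%fset ->
    modulus (l - \sum_(s <- X | s \in A) u s) < e.
Proof.
rewrite /has_sum /has_prod; split => [/cvg_modulusP h e /h /near_totally//|h].
by apply/cvg_modulusP => e /h ?; exact/near_totally.
Qed.

Lemma has_sumCP (R : realType) (T : choiceType) (A : set T)
    (u : T -> R[i]) (l : R[i]) :
  has_sum A u l <-> forall e : R, 0 < e -> exists X0 : {fset T},
    forall X : {fset T}, (X0 `<=` X)%fset ->
    nc (l - \sum_(s <- X | s \in A) u s) < e.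
Proof. exact: (@has_sumP R ComplexScalar T A u l). Qed.

Lemma has_prodP (R : realType) (k : scalar_kind) (T : choiceType) (A : set T)
    (u : T -> scalar_field R k) (l : scalar_field R k) :
  has_prod A u l <-> forall e : R, 0 < e -> exists X0 : {fset T},
    forall X : {fset T}, (X0 `<=` X)%fset ->
    modulus (l - \prod_(s <- X | s \in A) u s) < e.
Proof.
rewrite /has_sum /has_prod; split => [/cvg_modulusP h e /h /near_totally//|h].
by apply/cvg_modulusP => e /h ?; exact/near_totally.
Qed.

Lemma has_sum_toC (R : realType) (k : scalar_kind) (T : choiceType) (A : set T)
    (u : T -> scalar_field R k) (l : scalar_field R k) :
  has_sum A (fun s => toC (u s)) (toC l) -> has_sum A u l.
Proof.
move=> /has_sumCP h; apply/has_sumP => e /h[X0 h0]; exists X0 => X /h0.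
by rewrite modulusE rmorphB rmorph_sum.
Qed.

Lemma eq_has_sum (K : numFieldType) (T : choiceType) (A : set T) (u v : T -> K)
    (l : K) : {in A, u =1 v} -> has_sum A u l -> has_sum A v l.
Proof.
move=> uv; rewrite /has_sum (_ : (fun X => _) = fun X : {fset T} =>
    \sum_(s <- X | s \in A) v s) //.
by apply/funext => X; apply: eq_bigr => s /uv.
Qed.

(** Cauchy criterion along the net of finite sets, the tails being dominated by those of [w]. It is
    applied to real and imaginary parts with [w] the modulus. *)
Lemma psum_cvg (R : realType) (T : choiceType) (B D : set T) (u w : T -> R) :
  B `<=` D -> (forall s, `|u s| <= w s) -> (\esum_(s in D) (w s)%:E < +oo)%E ->
  cvg ((fun X : {fset T} => \sum_(s <- X | s \in B) u s) @ summability.totally).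
Proof.
move=> BD uw fin; apply: cauchy_cvg; apply: cauchy_exP => e e0.
have w0 s : 0 <= w s by exact: le_trans (uw s).
have [|X0 h] := @esum_tail _ _ D w (e / 2) w0 fin; first by rewrite divr_gt0.
exists (\sum_(s <- X0 | s \in B) u s); apply/near_totally; exists X0 => X X0X.
rewrite /ball /= distrC fset_sumB //; apply: le_lt_trans (ler_norm_sum _ _ _) _.
apply: (@le_lt_trans _ _ (e / 2)); last by lra.
apply: le_trans (h X); apply: le_fset_sum => // s /andP[+ sX0].
by rewrite !unfold_in sX0 andbT => /set_mem/BD/mem_set.
Qed.

Lemma has_sum_exists (R : realType) (T : choiceType) (B D : set T)
    (L : T -> R[i]) : B `<=` D -> (\esum_(s in D) (nc (L s))%:E < +oo)%E ->
  exists l, has_sum B L l.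
Proof.
move=> BD fin.
have /cvg_ex[x /cvgrPdist_lt hx] :=
  psum_cvg BD (fun s => normc_ge_Re (L s)) fin.
have /cvg_ex[y /cvgrPdist_lt hy] :=
  psum_cvg BD (fun s => normc_ge_Im (L s)) fin.
exists (x +i* y); apply/has_sumCP => e e0.
have e20 : 0 < e / 2 by rewrite divr_gt0.
have /near_totally[X1 h1] := hx _ e20; have /near_totally[X2 h2] := hy _ e20.
exists (X1 `|` X2)%fset => X; rewrite fsubUset => /andP[/h1 hX1 /h2 hX2].
apply: le_lt_trans (normc_le_ReIm _) _.
by rewrite !raddfB !raddf_sum /= !sumrN [ltRHS]splitr ltrD.
Qed.

(** The finite set [X0] depends on [D] only, not on [B]: the tail of the total mass bounds the error
    of every subsum. This gives uniformity in t for the sums over [[a, t[]. *)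
Lemma has_sum_uniform (R : realType) (T : choiceType) (D : set T)
    (L : T -> R[i]) (e : R) :
  (\esum_(s in D) (nc (L s))%:E < +oo)%E -> 0 < e ->
  exists X0 : {fset T}, forall X : {fset T}, (X0 `<=` X)%fset ->
  forall (B : set T) (l : R[i]), B `<=` D -> has_sum B L l ->
  nc (l - \sum_(s <- X | s \in B) L s) < e.
Proof.
move=> fin e0; have e20 : 0 < e / 2 by rewrite divr_gt0.
have [X0 h0] := esum_tail (fun s => normc_ge0 (L s)) fin e20.
exists X0 => X X0X B l BD /has_sumCP/(_ _ e20)[X1 h1].
(* Pass through a larger finite set [Y] on which the sum is already close to [l]; going from [X] to
   [Y] only adds terms of the tail. *)
have XY := fsubsetUl X X1; have /h1 hY := fsubsetUr X X1.
set Y := (X `|` X1)%fset in XY hY.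
rewrite -(subrKA (\sum_(s <- Y | s \in B) L s)) addrC.
apply: le_lt_trans (le_normcD _ _) _; rewrite [ltRHS]splitr ler_ltD //.
rewrite fset_sumB //; apply: le_trans (normc_sum _ _ _) _.
apply: le_trans (h0 Y); apply: le_fset_sum => // s; rewrite ?normc_ge0 //.
rewrite !unfold_in => /andP[/set_mem/BD/mem_set sD sX].
by apply/andP; split=> //; apply: contra sX; exact: (fsubsetP X0X).
Qed.

(** As the [B i] are disjoint and avoid [X0], each point of [D] outside [X0] is counted at most
    once, so all the sums together cost no more than one tail. *)
Lemma has_sum_disjoint_le (R : realType) (T : choiceType) (D : set T)
    (L : T -> R[i]) (e : R) :
  (\esum_(s in D) (nc (L s))%:E < +oo)%E -> 0 < e ->
  exists X0 : {fset T}, forall (m : nat) (B : 'I_m -> set T) (l : 'I_m -> R[i]),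
    (forall i, B i `<=` D) -> (forall i, has_sum (B i) L (l i)) ->
    trivIset setT B -> (forall i s, s \in X0 -> ~ B i s) ->
    \sum_(i < m) nc (l i) <= e.
Proof.
move=> fin e0; have e20 : 0 < e / 2 by rewrite divr_gt0.
have [X0 h0] := esum_tail (fun s => normc_ge0 (L s)) fin e20.
exists X0 => m B l BD Bl tB BX0.
(* Half of [e] is shared among the [m] finite approximations; [m.+1] keeps the divisor nonzero. *)
have em : 0 < e / 2 / m.+1%:R by rewrite divr_gt0.
have [X h] := has_sum_uniform fin em.
have {}h i := ltW (h X (fsubset_refl _) (B i) (l i) (BD i) (Bl i)).
apply: (@le_trans _ _ (\sum_(i < m) (e / 2 / m.+1%:R +
                     \sum_(s <- X | s \in B i) nc (L s)))).
  apply: ler_sum => i _; rewrite -[l i](subrK (\sum_(s <- X | s \in B i) L s)).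
  apply: le_trans (le_normcD _ _) _; apply: lerD => //; exact: normc_sum.
rewrite big_split /= sumr_const card_ord [leRHS]splitr; apply: lerD.
  rewrite -[leLHS]mulr_natr -mulrA ler_piMr ?(ltW e20) //.
  rewrite mulrC ler_pdivrMr ?ltr0n //.
  by rewrite mul1r ler_nat.
apply: le_trans (h0 X).
under eq_bigr do rewrite big_mkcond.
rewrite exchange_big /= [leRHS]big_mkcond; apply: ler_sum => s _.
have [[i Bis]|nB] := pselect (exists i, B i s).
  rewrite (bigD1 i) //= mem_set // big1 ?addr0 => [|j ji].
    have -> : s \in D by exact/mem_set/(BD i).
    by have -> : s \notin X0 by apply/negP => /(BX0 i).
  rewrite ifF //; apply/negP => /set_mem Bjs.
  by move: ji; rewrite (tB j i) ?eqxx //; exists s.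
rewrite big1 => [|i _]; first by case: ifP; rewrite ?normc_ge0.
by rewrite ifF //; apply/negP => /set_mem Bis; apply: nB; exists i.
Qed.

Lemma has_sum_setD (R : realType) (T : choiceType) (A B : set T)
    (u : T -> R[i]) (l m : R[i]) : B `<=` A ->
  has_sum A u l -> has_sum B u m -> has_sum (A `\` B) u (l - m).
Proof.
move=> BA /has_sumCP hA /has_sumCP hB; apply/has_sumCP => e e0.
have e20 : 0 < e / 2 by rewrite divr_gt0.
have [X1 h1] := hA _ e20; have [X2 h2] := hB _ e20.
exists (X1 `|` X2)%fset => X; rewrite fsubUset => /andP[/h1 {}h1 /h2 {}h2].
have E : \sum_(s <- X | s \in A) u s =
         \sum_(s <- X | s \in B) u s + \sum_(s <- X | s \in A `\` B) u s.
  rewrite (bigID (fun s => s \in B)) /=; congr (_ + _); apply: eq_bigl => s.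
    by apply/andP/idP => [[]//|sB]; split=> //; apply/mem_set/BA/set_mem.
  by rewrite in_setD.
rewrite (_ : l - m - _ = (l - \sum_(s <- X | s \in A) u s) -
                         (m - \sum_(s <- X | s \in B) u s)); last first.
  by rewrite E; ring.
apply: le_lt_trans (le_normcD _ _) _; rewrite normcN; lra.
Qed.

Lemma has_sum_set1 (R : realType) (T : choiceType) (t : T) (u : T -> R[i]) :
  has_sum [set t] u (u t).
Proof.
apply/has_sumCP => e e0; exists [fset t]%fset => X; rewrite fsub1set => tX.
rewrite big_mkcond (bigD1_seq t) ?fset_uniq //= mem_set // big1 ?addr0.
  by rewrite subrr Normc.normc0.
by move=> s st; rewrite ifF //; apply/negP => /set_mem /eqP; exact/negP.
Qed.

(** * Telescoping products and exponentials of unordered sums *)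

(** In increasing order each summand is the difference of two consecutive partial products. The
    induction appends a largest element, which leaves the earlier products unchanged. *)
Lemma sum_mul_prod_lt (K : comPzRingType) d (T : orderType d) (E : T -> K)
    (l : seq T) : sorted <%O l ->
  \sum_(s <- l) (E s - 1) * \prod_(r <- l | (r < s)%O) E r =
  \prod_(s <- l) E s - 1.
Proof.
rewrite sorted_pairwise; last exact: lt_trans.
elim/last_ind: l => [|l x IH]; first by rewrite !big_nil subrr.
rewrite pairwise_rcons => /andP[/allP lx /IH {}IH].
have E1 : \prod_(r <- rcons l x | (r < x)%O) E r = \prod_(r <- l) E r.
  rewrite big_rcons_op /= ltxx.
  by rewrite big_mkcond; apply: eq_big_seq => r /lx ->.
rewrite -cats1 !big_cat /= !big_seq1.
rewrite [X in X + _](_ : _ = \prod_(r <- l) E r - 1); last first.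
  rewrite -IH; apply: eq_big_seq => s sl; congr (_ * _).
  by rewrite big_cat /= big_cons big_nil ltNge (ltW (lx _ sl)) /= mulr1.
by rewrite cats1 E1; ring.
Qed.

(** Write e^x - e^y = e^y (e^(x-y) - 1) with |x - y| <= 2M; the factors e^M and e^(2M) combine into
    the constant. *)
Lemma cexp_lipschitz (R : realType) (M : R) (x y : R[i]) :
  nc x <= M -> nc y <= M ->
  nc (cexp x - cexp y) <= 3 * expR (3 * M) * nc (x - y).
Proof.
move=> xM yM; have -> : cexp x - cexp y = cexp y * (cexp (x - y) - 1).
  by rewrite mulrBr -cexpD mulr1 (addrC y) subrK.
have xyM : nc (x - y) <= 2 * M.
  by apply: le_trans (le_normcD _ _) _; rewrite normcN; lra.
have -> : 3 * M = M + 2 * M by ring.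
rewrite Normc.normcM expRD.
rewrite (_ : 3 * _ * _ = expR M * (3 * nc (x - y) * expR (2 * M))); last by ring.
apply: ler_pM; rewrite ?normc_ge0 //.
  by apply: le_trans (normc_cexp_le _) _; rewrite ler_expR.
apply: le_trans (normc_cexpB1 _) _; apply: ler_wpM2l; last by rewrite ler_expR.
by rewrite mulr_ge0 ?normc_ge0.
Qed.

Lemma fset_sum_le_fine_esum (R : realType) (T : choiceType) (D : set T)
    (w : T -> R) (X : {fset T}) : (forall s, 0 <= w s) ->
  (\esum_(s in D) (w s)%:E < +oo)%E ->
  \sum_(s <- X | s \in D) w s <= fine (\esum_(s in D) (w s)%:E).
Proof.
move=> w0 fin; rewrite -lee_fin fineK ?fset_sum_le_esum //.
by rewrite ge0_fin_numE // esum_ge0 // => s _; rewrite lee_fin.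
Qed.

Lemma normc_fset_sum_le (R : realType) (T : choiceType) (B D : set T)
    (L : T -> R[i]) (X : {fset T}) : B `<=` D ->
  (\esum_(s in D) (nc (L s))%:E < +oo)%E ->
  nc (\sum_(s <- X | s \in B) L s) <= fine (\esum_(s in D) (nc (L s))%:E).
Proof.
move=> BD fin; apply: le_trans (normc_sum _ _ _) _.
apply: le_trans (fset_sum_le_fine_esum X _ fin) => [|s]; last exact: normc_ge0.
apply: le_fset_sum => // s; first exact: normc_ge0.
by rewrite !unfold_in => /set_mem/BD/mem_set.
Qed.

Lemma normc_has_sum_le (R : realType) (T : choiceType) (B D : set T)
    (L : T -> R[i]) (l : R[i]) : B `<=` D ->
  (\esum_(s in D) (nc (L s))%:E < +oo)%E -> has_sum B L l ->
  nc l <= fine (\esum_(s in D) (nc (L s))%:E).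
Proof.
move=> BD fin /has_sumCP h; apply/ler_addgt0Pr => e /h[X /(_ X (fsubset_refl _))].
move=> hX; rewrite -[l](subrK (\sum_(s <- X | s \in B) L s)).
apply: le_trans (le_normcD _ _) _; rewrite addrC; apply: lerD; last exact: ltW.
exact: normc_fset_sum_le.
Qed.

(* For a finite [X], the partial sums [P s] of [L] over [X] give a telescoping
   sum of the jumps of [cexp \o P]; since [P] is uniformly close to [S] once [X]
   is large, replacing [P] by [S] costs at most a multiple of the total mass. *)
Lemma has_sum_cexp_jumps (R : realType) (a : R) (D : set R) (L S : R -> R[i]) :
  (\esum_(s in D) (nc (L s))%:E < +oo)%E ->
  (forall t, has_sum (`[a, t[ `&` D) L (S t)) ->
  forall t, has_sum (`[a, t[ `&` D) (fun s => (cexp (L s) - 1) * cexp (S s))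
                    (cexp (S t) - 1).
Proof.
move=> fin hS t; set M := fine (\esum_(s in D) (nc (L s))%:E).
have ID s : `[a, s[ `&` D `<=` D by move=> r [].
have SM s : nc (S s) <= M := normc_has_sum_le (ID s) fin (hS s).
have M0 : 0 <= M := le_trans (normc_ge0 _) (SM t).
have LM s : D s -> nc (L s) <= M.
  move=> Ds; have sD : [set s] `<=` D by move=> _ ->.
  exact: normc_has_sum_le sD fin (@has_sum_set1 R R s L).
pose C := 3 * expR (3 * M).
have C0 : 0 < C by rewrite mulr_gt0 ?expR_gt0.
apply/has_sumCP => e e0.
(* The final error is at most (C M C + C) [e1]; the extra 1 makes the inequality strict. *)
pose e1 := e / (C * M * C + C + 1).
have K0 : 0 < C * M * C + C + 1.
  by rewrite addr_gt0 // ltr_wpDl // !mulr_ge0 // ltW.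
have e10 : 0 < e1 by rewrite divr_gt0.
have Ce0 : 0 <= C * e1 by rewrite mulr_ge0 ?ltW.
have [X0 h0] := has_sum_uniform fin e10; exists X0 => X X0X.
pose P s := \sum_(r <- X | r \in `[a, s[ `&` D) L r.
have SP s : nc (cexp (S s) - cexp (P s)) <= C * e1.
  apply: le_trans (cexp_lipschitz (SM s) (normc_fset_sum_le X (ID s) fin)) _.
  by rewrite ler_wpM2l ?(ltW C0) // ltW // h0.
have tele : \sum_(s <- X | s \in `[a, t[ `&` D) (cexp (L s) - 1) * cexp (P s) =
            cexp (P t) - 1.
  (* Only a finite set is sorted here, so telescoping applies even if [D] is dense. *)
  pose l := sort <=%O [seq s <- X | s \in `[a, t[ `&` D].
  have ls : sorted <%O l.
    rewrite lt_sorted_uniq_le sort_uniq filter_uniq ?fset_uniq //=.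
    exact: sort_le_sorted.
  have := sum_mul_prod_lt (fun s => cexp (L s)) ls.
  have pl : perm_eq l [seq s <- X | s \in `[a, t[ `&` D].
    exact/permPl/perm_sort.
  rewrite (perm_big _ pl) (perm_big _ pl) /= !big_filter -cexp_sum => <-.
  apply: eq_bigr => s /set_mem[sat Ds]; congr (_ * _).
  rewrite (perm_big _ pl) big_filter_cond -cexp_sum; congr cexp.
  apply: eq_bigl => r; move: sat; rewrite /= !in_itv /= => /andP[_ st].
  apply/idP/andP => [/set_mem[]|[/set_mem[]]]; rewrite /= !in_itv /=.
    move=> /andP[ar rs] Dr; split=> //; apply/mem_set; split=> //=.
    by rewrite in_itv /= ar (lt_trans rs).
  by move=> /andP[ar rt] Dr rs; apply/mem_set; split; rewrite //= in_itv /= ar.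
(* Two errors remain: [P t] for [S t] at the endpoint, and [P s] for [S s] inside the sum. *)
rewrite -(subrKA (cexp (P t) - 1)) -{2}tele -sumrB.
apply: (@le_lt_trans _ _ (C * M * (C * e1) + C * e1)).
  rewrite addrC; apply: le_trans (le_normcD _ _) _; apply: lerD; last first.
    by rewrite opprB addrA subrK.
  apply: le_trans (normc_sum _ _ _) _.
  (* Comparing [L s] with 0 gives |e^(L s) - 1| <= C |L s|, so the errors are weighted by a mass of
     total at most [M]. *)
  apply: (@le_trans _ _ (\sum_(s <- X | s \in D) C * nc (L s) * (C * e1))).
    apply: le_fset_sum => [s|s|s].
    - by rewrite mulr_ge0 // mulr_ge0 ?normc_ge0 ?ltW.
    - move=> /set_mem[_ Ds]; rewrite -mulrBr Normc.normcM.
      rewrite ler_pM ?normc_ge0 //; last by rewrite normc_distC.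
      have := @cexp_lipschitz R M (L s) 0 (LM _ Ds).
      by rewrite Normc.normc0 cexp0 subr0; apply.
    - by rewrite !unfold_in => /set_mem[_ /mem_set].
  rewrite -mulr_suml -mulr_sumr ler_wpM2r // ler_pM2l //.
  by apply: fset_sum_le_fine_esum => // s; exact: normc_ge0.
rewrite (_ : _ + _ = (C * M * C + C) * e1); last by ring.
by rewrite /e1 mulrA ltr_pdivrMr // mulrC ltr_pM2l // ltrDl.
Qed.

(** * Jumps of a non-decreasing function *)

Lemma nondecreasing_rlim_cvg (R : realType) (g : R -> R) (t : R) :
  {homo g : x y / x <= y} -> g x @[x --> t^'+] --> (rlim g t : R).
Proof.
move=> gm; apply: (@nondecreasing_at_right_is_cvgr R g t).
  by near=> x => y z _ _; exact: gm.
near=> x; exists (g t) => z [y]; rewrite /= in_itv /= => /andP[ty _] <-.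
exact/gm/ltW.
Unshelve. all: by end_near. Qed.

Lemma rlim_le (R : realType) (g : R -> R) (x y : R) :
  {homo g : x y / x <= y} -> x < y -> rlim g x <= g y.
Proof.
move=> gm xy; apply: limr_le; first exact: nondecreasing_rlim_cvg.
by near=> s; apply: gm; near: s; exact: nbhs_right_le.
Unshelve. all: by end_near. Qed.

Lemma rlim_ge (R : realType) (g : R -> R) (x : R) :
  {homo g : x y / x <= y} -> g x <= rlim g x.
Proof.
move=> gm; apply: limr_ge; first exact: nondecreasing_rlim_cvg.
by near=> s; apply: gm; near: s; exact: nbhs_right_ge.
Unshelve. all: by end_near. Qed.

Lemma jump_ge0 (R : realType) (g : R -> R) (x : R) :
  {homo g : x y / x <= y} -> 0 <= jump g x.
Proof. by move=> gm; rewrite subr_ge0 rlim_ge. Qed.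

Lemma jump_le (R : realType) (g : R -> R) (x y s : R) :
  {homo g : x y / x <= y} -> x <= s < y -> jump g s <= g y - g x.
Proof.
move=> gm /andP[xs sy]; apply: lerB; [exact: rlim_le|exact: gm].
Qed.

(** The right limit at one point is at most the value at the next, so the jumps telescope. Starting
    from [rlim g x], just after the jump at [x], gives the form that the induction needs. *)
Lemma path_sum_jump_le (R : realType) (g : R -> R) (x y : R) (l : seq R) :
  {homo g : x y / x <= y} -> path <%R x l -> last x l < y ->
  rlim g x + \sum_(s <- l) jump g s <= g y.
Proof.
move=> gm; elim: l x => [|s l IH] x /=.
  by move=> _ xy; rewrite big_nil addr0; exact: rlim_le.
move=> /andP[xs sl] /(IH s sl); rewrite big_cons /jump.
have := rlim_le gm xs; lra.
Qed.

Lemma fset_sum_jump_le (R : realType) (g : R -> R) (x y : R) (X : {fset R}) :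
  {homo g : x y / x <= y} -> x <= y ->
  \sum_(s <- X | s \in `[x, y[) jump g s <= g y - g x.
Proof.
move=> gm xy; pose l := sort <=%R [seq s <- X | s \in `[x, y[].
have ls : sorted <%R l.
  rewrite lt_sorted_uniq_le sort_uniq filter_uniq ?fset_uniq //=.
  exact: sort_le_sorted.
have pl : perm_eq l [seq s <- X | s \in `[x, y[] by exact/permPl/perm_sort.
rewrite -big_filter -(perm_big _ pl).
have {pl} lxy s : s \in l -> x <= s < y.
  by rewrite (perm_mem pl) mem_filter in_itv /= => /andP[].
case: l ls lxy => [|s l] /=; first by rewrite big_nil subr_ge0 => *; exact: gm.
move=> sl lxy; have /andP[/gm xs _] := lxy s (mem_head _ _).
have /andP[_ ly] := lxy _ (mem_last s l).
have := path_sum_jump_le gm sl ly; rewrite big_cons /jump; lra.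
Qed.

Lemma esum_jump_le (R : realType) (g : R -> R) (x y : R) :
  {homo g : x y / x <= y} -> x <= y ->
  (\esum_(s in `[x, y[ `&` jump_set g) (jump g s)%:E <= (g y - g x)%:E)%E.
Proof.
move=> gm xy; apply: ge_ereal_sup => _ [A [Af AI] <-].
rewrite fsumEFin // lee_fin fsbig_finite //=.
rewrite (_ : \sum_(s <- _) _ = \sum_(s <- fset_set A | s \in `[x, y[) jump g s).
  exact: fset_sum_jump_le.
rewrite [RHS]big_mkcond; apply: eq_big_seq => s.
by rewrite in_fset_set // => /set_mem/AI[] /=; rewrite /= => ->.
Qed.

Lemma esum_jump_cat (R : realType) (g : R -> R) (x y z : R) :
  {homo g : x y / x <= y} -> x <= y -> y <= z ->
  fine (\esum_(s in `[x, z[ `&` jump_set g) (jump g s)%:E) =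
  fine (\esum_(s in `[x, y[ `&` jump_set g) (jump g s)%:E) +
  fine (\esum_(s in `[y, z[ `&` jump_set g) (jump g s)%:E).
Proof.
move=> gm xy yz.
have fin u v : u <= v ->
    \esum_(s in `[u, v[ `&` jump_set g) (jump g s)%:E \is a fin_num.
  move=> uv; rewrite ge0_fin_numE.
    exact: le_lt_trans (esum_jump_le gm uv) (ltry _).
  by apply: esum_ge0 => s _; rewrite lee_fin jump_ge0.
rewrite -fineD ?fin //; congr fine.
rewrite (esumID `[x, y[%classic); last by move=> s _; rewrite lee_fin jump_ge0.
congr (_ + _)%E; congr esum; apply/seteqP; split => s /=; rewrite !in_itv /=.
- by move=> [[_ ?] ?].
- by move=> [/andP[-> sy] ?]; rewrite sy (lt_le_trans sy).
- move=> [[/andP[xs ->] ?] /negP]; rewrite xs /= -leNgt => ->.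
  by [].
- move=> [/andP[ys ->] ?]; rewrite (le_trans xy) //=; split=> //.
  by apply/negP; rewrite -leNgt.
Qed.

(** Both branches of [jump_part] come from one additive interval function; when x <= 0 < y the two
    pieces are glued at 0. Increments thus become jump masses, whatever the position of the
    origin. *)
Lemma jump_partB (R : realType) (g : R -> R) (x y : R) :
  {homo g : x y / x <= y} -> x <= y ->
  jump_part g y - jump_part g x =
  fine (\esum_(s in `[x, y[ `&` jump_set g) (jump g s)%:E).
Proof.
move=> gm xy; rewrite /jump_part; case: ltP => y0; case: ltP => x0.
- by rewrite (esum_jump_cat gm (ltW x0) xy) addrC addKr.
- by rewrite opprK (esum_jump_cat gm x0 (ltW y0)) addrC.
- by have := lt_le_trans x0 xy; rewrite ltNge y0.
- by rewrite opprK (esum_jump_cat gm xy y0) addrC addrK.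
Qed.

Lemma jump_part_nondecreasing (R : realType) (g : R -> R) :
  {homo g : x y / x <= y} -> {homo jump_part g : x y / x <= y}.
Proof.
move=> gm x y xy; rewrite -subr_ge0 jump_partB // fine_ge0 // esum_ge0 // => s _.
by rewrite lee_fin jump_ge0.
Qed.

Lemma jump_part_jump_le (R : realType) (g : R -> R) (x y s : R) :
  {homo g : x y / x <= y} -> jump_set g s -> x <= s < y ->
  jump g s <= jump_part g y - jump_part g x.
Proof.
move=> gm gs /andP[xs sy]; have xy := ltW (le_lt_trans xs sy).
rewrite jump_partB //.
have := @fset_sum_le_fine_esum R R (`[x, y[ `&` jump_set g) (jump g)
  [fset s]%fset.
rewrite big_mkcond big_seq_fset1 mem_set; last by split; rewrite //= in_itv /= xs.
apply=> [r|]; first exact: jump_ge0.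
exact: le_lt_trans (esum_jump_le gm xy) (ltry _).
Qed.

(** * The exponential of the cumulative sum of logarithms *)

(** A minimum of finitely many positive numbers, used to choose a radius once finitely many points
    of the jump set have been singled out. *)
Lemma seq_pos_lower_bound (R : realType) (T : eqType) (P : T -> Prop)
    (J : T -> R) (l : seq T) : (forall s, P s -> 0 < J s) ->
  exists2 d : R, 0 < d & forall s, s \in l -> P s -> d <= J s.
Proof.
move=> J0; elim: l => [|r l [d d0 h]]; first by exists 1.
have [Pr|nPr] := pselect (P r).
  exists (Num.min d (J r)); first by rewrite lt_min d0 J0.
  move=> s; rewrite inE => /orP[/eqP ->|sl] Ps; rewrite ge_min ?lexx ?orbT //.
  by rewrite h.
by exists d => // s; rewrite inE => /orP[/eqP ->//|]; exact: h.
Qed.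

Lemma itv_setD_has_sum (R : realType) (a c q : R) (D : set R) (L : R -> R[i])
    (x y : R[i]) : a <= c -> c <= q ->
  has_sum (`[a, q[ `&` D) L x -> has_sum (`[a, c[ `&` D) L y ->
  has_sum (`[c, q[ `&` D) L (x - y).
Proof.
move=> ac cq hx hy.
have -> : `[c, q[ `&` D = (`[a, q[ `&` D) `\` (`[a, c[ `&` D).
  apply/seteqP; split => s; rewrite /= !in_itv /=.
    move=> [/andP[cs ->] Ds]; rewrite (le_trans ac cs); split => // -[/andP[_]].
    by rewrite ltNge cs.
  move=> [[/andP[as_ ->] Ds] h]; split => //; rewrite andbT leNgt.
  by apply/negP => sc; apply: h; rewrite as_ sc.
apply: has_sum_setD => // s [] /=; rewrite !in_itv /= => /andP[-> sc] Ds.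
by rewrite (lt_le_trans sc cq).
Qed.

(** Stated for a general [h] so as to serve both [g] and its jump part. A family with small total
    [h]-increment misses the finitely many points of [X0], so the increments of [S] over it lie in a
    tail; the Lipschitz bound passes this on to [phi]. *)
Lemma AC_wrt_cexp (R : realType) (k : scalar_kind) (a b : R) (D : set R)
    (L S : R -> R[i]) (phi : R -> scalar_field R k) (h J : R -> R) :
  (\esum_(s in D) (nc (L s))%:E < +oo)%E ->
  (forall t, has_sum (`[a, t[ `&` D) L (S t)) ->
  (forall t, toC (phi t) = cexp (S t)) ->
  {homo h : x y / x <= y} ->
  (forall s, D s -> 0 < J s) ->
  (forall s x y, D s -> x <= s < y -> J s <= h y - h x) ->
  AC_wrt a b h phi.
Proof.
move=> fin hS phiS hm J0 Jh e e0; set M := fine (\esum_(s in D) (nc (L s))%:E).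
have SM s : nc (S s) <= M by apply: normc_has_sum_le fin (hS s) => r [].
pose C := 3 * expR (3 * M).
have C0 : 0 < C by rewrite mulr_gt0 ?expR_gt0.
have e10 : 0 < e / (C + 1) by rewrite divr_gt0 // addr_gt0.
have [X0 h0] := has_sum_disjoint_le fin e10.
have [d d0 hd] := seq_pos_lower_bound X0 J0.
exists d => // m c q cq tcq small.
have hcq i : c i <= q i by have [_ [/ltW]] := cq i.
have -> : e = (C + 1) * (e / (C + 1)) by rewrite mulrC divfK // gt_eqF ?addr_gt0.
apply: (@le_lt_trans _ _ (C * (e / (C + 1)))); last first.
  by rewrite ltr_pM2r // ltrDl.
apply: (@le_trans _ _ (C * \sum_(i < m) nc (S (q i) - S (c i)))).
  rewrite mulr_sumr; apply: ler_sum => i _.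
  by rewrite modulusE rmorphB /= !phiS; exact: cexp_lipschitz.
rewrite ler_pM2l //.
apply: (h0 m (fun i => `[c i, q i[ `&` D)).
- by move=> i s [].
- by move=> i; apply: (itv_setD_has_sum (cq i).1 (hcq i)).
(* Disjoint open intervals have disjoint half-open versions: a common point [s] would be followed by
   common interior points, such as the midpoint of [s] and the smaller right end. *)
- move=> i j _ _ [s [[/= + _] [/= + _]]]; rewrite !in_itv /=.
  move=> /andP[cis sqi] /andP[cjs sqj]; apply: (tcq i j I I).
  pose z := Num.min (q i) (q j); have sz : s < z by rewrite lt_min sqi sqj.
  have [zi zj] : z <= q i /\ z <= q j by rewrite !ge_min !lexx orbT.
  by exists ((s + z) / 2); split; rewrite /= in_itv /=; apply/andP; split; lra.
(* A point of [X0] in one of the intervals would alone force an increment of at least [d]. *)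
- move=> i s sX0 [/=]; rewrite in_itv /= => sI Ds.
  have := Jh s _ _ Ds sI; apply/negP; rewrite -ltNge.
  apply: (lt_le_trans _ (hd s sX0 Ds)); apply: le_lt_trans small.
  rewrite (bigD1 i) //= lerDl sumr_ge0 // => j _.
  by rewrite subr_ge0 hm.
Qed.

(** Absolute continuity is tested on a family made of a single interval. *)
Lemma AC_wrt_gcontinuous (R : realType) (k : scalar_kind) (a b : R)
    (h : R -> R) (F : R -> scalar_field R k) :
  {homo h : x y / x <= y} -> AC_wrt a b h F -> gcontinuous a b h F.
Proof.
move=> hm AC t tab e e0; have [d d0 hd] := AC e e0; exists d => // s sab.
have lt x y : a <= x -> x < y -> y <= b -> h y - h x < d ->
    modulus (F y - F x) < e.
  move=> ax xy yb hxy.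
  have := hd 1%N (fun=> x) (fun=> y); rewrite !big_ord1; apply => //.
  by move=> i j; rewrite !ord1.
move: tab sab => /andP[at_ tb] /andP[as_ sb].
have [ts|st|->] := ltgtP t s; last by move=> *; rewrite subrr modulus0.
  rewrite distrC ger0_norm ?subr_ge0 ?hm ?ltW // => hts.
  by rewrite -modulusN opprB; exact: lt.
by rewrite ger0_norm ?subr_ge0 ?hm ?ltW // => hts; exact: lt.
Qed.

(** Once the jump of [S] at [t] is removed, the increment of [S] from [t] to [s] is the sum over the
    open interval []t, s[]. For [s] close to [t] this interval avoids [X0], so the sum lies in a
    tail. *)
Lemma cexp_has_sum_right (R : realType) (k : scalar_kind) (a t : R) (D : set R)
    (L S : R -> R[i]) (phi : R -> scalar_field R k) (m : scalar_field R k) :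
  (\esum_(s in D) (nc (L s))%:E < +oo)%E ->
  (forall t, has_sum (`[a, t[ `&` D) L (S t)) ->
  (forall t, toC (phi t) = cexp (S t)) -> a <= t ->
  toC m = (if t \in D then cexp (L t) else 1) ->
  phi x @[x --> t^'+] --> phi t * m.
Proof.
move=> fin hS phiS at_ hm; set M := fine (\esum_(s in D) (nc (L s))%:E).
have SM s : nc (S s) <= M by apply: normc_has_sum_le fin (hS s) => r [].
have M0 : 0 <= M := le_trans (normc_ge0 _) (SM t).
(* The jump of [S] at [t]. *)
pose j := if t \in D then L t else 0.
have jM : nc j <= M.
  rewrite /j; case: ifPn => tD; last by rewrite Normc.normc0.
  have tD' : [set t] `<=` D by move=> _ ->; exact: set_mem.
  exact: normc_has_sum_le tD' fin (@has_sum_set1 R R t L).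
have {}hm : toC m = cexp j by rewrite hm /j; case: ifP => // _; rewrite cexp0.
have hj s : t < s -> has_sum (`]t, s[ `&` D) L (S s - S t - j).
  move=> ts; have := itv_setD_has_sum at_ (ltW ts) (hS s) (hS t).
  rewrite /j; case: ifPn => tD h.
    have -> : `]t, s[ `&` D = (`[t, s[ `&` D) `\` [set t].
      apply/seteqP; split => r; rewrite /= !in_itv /=.
        move=> [/andP[tr ->] Dr]; rewrite (ltW tr); split=> // rt.
        by rewrite rt ltxx in tr.
      move=> [[/andP[tr ->] Dr] rt]; split=> //; rewrite andbT lt_neqAle tr andbT.
      by apply/eqP => /esym.
    have tI : [set t] `<=` `[t, s[ `&` D.
      by move=> _ ->; split; [rewrite /= in_itv /= lexx|exact: set_mem].
    exact: has_sum_setD tI h (@has_sum_set1 R R t L).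
  rewrite subr0; have -> // : `]t, s[ `&` D = `[t, s[ `&` D.
  apply/seteqP; split => r; rewrite /= !in_itv /= => -[/andP[tr ->] Dr].
    by rewrite (ltW tr).
  split => //; rewrite andbT lt_neqAle tr andbT; apply: contra tD => /eqP ->.
  exact: mem_set.
(* The exponents compared are [S s] and [S t + j], where [S t] and [j] are each bounded by [M]. *)
pose C := 3 * expR (3 * (2 * M)).
have C0 : 0 < C by rewrite mulr_gt0 ?expR_gt0.
apply/cvg_modulusP => e e0.
have e10 : 0 < e / (C + 1) by rewrite divr_gt0 // addr_gt0.
have [X0 h0] := has_sum_disjoint_le fin e10.
have [d d0 hd] :
    exists2 d : R, 0 < d & forall s, s \in X0 -> t < s -> d <= s - t.
  by apply: (seq_pos_lower_bound _ (P := fun s => t < s)) => s; rewrite subr_gt0.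
near=> s.
have ts : t < s by near: s; exact: nbhs_right_gt.
have sd : s < t + d by near: s; apply: nbhs_right_lt; rewrite ltrDl.
have small : nc (S s - S t - j) <= e / (C + 1).
  have := h0 1%N (fun=> `]t, s[ `&` D) (fun=> S s - S t - j).
  rewrite big_ord1; apply.
  - by move=> _ r [].
  - by move=> _; exact: hj.
  - by move=> x y; rewrite !ord1.
  - move=> _ r rX0 [/=]; rewrite in_itv /= => /andP[tr rs] _.
    have := hd r rX0 tr; lra.
rewrite modulusE rmorphB rmorphM /= !phiS hm -cexpD normc_distC.
apply: (@le_lt_trans _ _ (C * (e / (C + 1)))); last first.
  by rewrite mulrA ltr_pdivrMr ?addr_gt0 // mulrC ltr_pM2l // ltrDl.
apply: (@le_trans _ _ (C * nc (S s - S t - j))); last by rewrite ler_pM2l.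
rewrite -addrA -opprD; apply: cexp_lipschitz.
  by rewrite (le_trans (SM s)) // mulr2n mulrDl mul1r lerDl.
by apply: le_trans (le_normcD _ _) _; have := SM t; lra.
Unshelve. all: by end_near. Qed.

(** * Continuity of quotients, one-sided criteria and convergence of products *)

(** Separates the variation of the numerator from that of the denominator, each with a factor that
    can be bounded. *)
Lemma div_sub_div (K : fieldType) (x y p q : K) : p != 0 -> q != 0 ->
  x / p - y / q = (x - y) / p + - (y * ((p - q) * (p^-1 * q^-1))).
Proof. by move=> p0 q0; field; rewrite p0 q0. Qed.

Lemma gcontinuous_div (R : realType) (k : scalar_kind) (a b M B : R)
    (g : R -> R) (u v : R -> scalar_field R k) :
  (forall t, a <= t <= b -> modulus (u t) <= M) ->
  (forall t, v t != 0) -> (forall t, modulus (v t)^-1 <= B) ->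
  gcontinuous a b g u -> gcontinuous a b g v ->
  gcontinuous a b g (fun t => u t / v t).
Proof.
move=> uM v0 vB gu gv t tab e e0.
have M0 : 0 <= M := le_trans (modulus_ge0 _) (uM t tab).
have B0 : 0 <= B := le_trans (modulus_ge0 _) (vB t).
(* [B] and [M * (B * B)] bound the coefficients of the two variations; the 1 makes [K] positive and
   the estimate strict. *)
pose K := B + M * (B * B) + 1.
have K0 : 0 < K by rewrite ltr_wpDl // addr_ge0 // !mulr_ge0.
have e10 : 0 < e / K by rewrite divr_gt0.
have [d1 d10 h1] := gu t tab _ e10; have [d2 d20 h2] := gv t tab _ e10.
exists (Num.min d1 d2); first by rewrite lt_min d10.
move=> s sab; rewrite lt_min => /andP[/(h1 s sab) {}h1 /(h2 s sab) {}h2].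
rewrite div_sub_div //; apply: le_lt_trans (modulusD_le _ _) _.
rewrite modulusN !modulusM.
have -> : e = K * (e / K) by rewrite mulrC divfK // gt_eqF.
apply: (@le_lt_trans _ _ ((B + M * (B * B)) * (e / K))); last first.
  by rewrite ltr_pM2r // ltrDl.
rewrite mulrDl; apply: lerD.
  by rewrite mulrC ler_pM ?modulus_ge0 // ltW.
rewrite -!mulrA ler_pM ?modulus_ge0 ?uM ?mulr_ge0 ?modulus_ge0 //.
rewrite mulrC mulrA ler_pM ?modulus_ge0 ?mulr_ge0 ?modulus_ge0 ?(ltW h2) //.
by rewrite ler_pM ?modulus_ge0.
Qed.

Lemma within_continuous_left_right (R : realType) (k : scalar_kind) (a b : R)
    (u : R -> scalar_field R k) :
  (forall t, a <= t <= b -> forall e, 0 < e ->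
    \forall s \near t^'-, a <= s -> modulus (u t - u s) < e) ->
  (forall t, a <= t < b -> forall e, 0 < e ->
    \forall s \near t^'+, s <= b -> modulus (u t - u s) < e) ->
  {within `[a, b], continuous u}.
Proof.
move=> hl hr; apply/subspace_continuousP => t; rewrite /= in_itv /= => tab.
apply/cvg_modulusP => e e0; have {}hl := hl t tab e e0.
(* At [t = b] the condition on the right is vacuous. *)
have {}hr : \forall s \near t^'+, s <= b -> modulus (u t - u s) < e.
  case: (ltP t b) => [tb|bt]; first by apply: hr; rewrite ?tb ?(andP tab).1.
  near=> s => sb; have ts : t < s by near: s; exact: nbhs_right_gt.
  by have := lt_le_trans ts (le_trans sb bt); rewrite ltxx.
move: hl hr; rewrite /at_left /at_right !near_withinE => hl hr.
near=> s => /=; rewrite in_itv /= => /andP[as_ sb].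
have [ts|st|<-] := ltgtP t s; last by move=> *; rewrite subrr modulus0.
- have : t < s -> s <= b -> modulus (u t - u s) < e by near: s.
  exact.
- have : s < t -> a <= s -> modulus (u t - u s) < e by near: s.
  exact.
Unshelve. all: by end_near. Qed.

(** The exponential turns finite partial sums into finite products and is Lipschitz on bounded sets.
    The estimate serves twice: to show that e^l is a scalar, and to obtain the product formula. *)
Lemma cexp_has_sum_prod (R : realType) (k : scalar_kind) (T : choiceType)
    (B D : set T) (L : T -> R[i]) (l : R[i]) (c : T -> scalar_field R k)
    (e : R) : B `<=` D ->
  (\esum_(s in D) (nc (L s))%:E < +oo)%E -> has_sum B L l ->
  (forall s, B s -> toC (c s) = cexp (L s)) -> 0 < e ->
  exists X0 : {fset T}, forall X : {fset T}, (X0 `<=` X)%fset ->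
    nc (cexp l - toC (\prod_(s <- X | s \in B) c s)) < e.
Proof.
move=> BD fin hl cL e0; set M := fine (\esum_(s in D) (nc (L s))%:E).
pose C := 3 * expR (3 * M).
have C0 : 0 < C by rewrite mulr_gt0 ?expR_gt0.
have e10 : 0 < e / C by rewrite divr_gt0.
have [X0 h0] := (has_sumCP _ _ _).1 hl _ e10; exists X0 => X /h0 hX.
rewrite rmorph_prod /=.
rewrite (_ : \prod_(s <- X | _) _ = cexp (\sum_(s <- X | s \in B) L s)).
  apply: le_lt_trans (cexp_lipschitz (normc_has_sum_le BD fin hl)
                                     (normc_fset_sum_le X BD fin)) _.
  by rewrite -/M -/C mulrC -ltr_pdivlMr.
by rewrite cexp_sum; apply: eq_bigr => s /set_mem /cL.
Qed.

(** * The factorisation of [f] *)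

Theorem proposition6p6 (R : realType) (k : scalar_kind) (a b : R)
    (g : R -> R) (f : R -> scalar_field R k)
    (ab : a < b)
    (g_nondecreasing : {homo g : x y / x <= y})
    (g_left_continuous : forall t : R, g x @[x --> t^'-] --> g t)
    (f_BCg : BC_wrt a b g f)
    (f_right_limits : forall t : R, jump_set g t -> a <= t < b ->
       cvg (f x @[x --> t^'+]))
    (f_nonzero_right : forall t : R, common_jump_set a b g f t ->
       exists2 d : R, 0 < d < b - t &
         forall s : R, t <= s < t + d -> f s != 0)
    (alpha : R)
    (logs_defined : forall t : R, common_jump_set a b g f t ->
       rlim f t != 0 /\ f t != 0)
    (logs_summable :
       (\esum_(t in common_jump_set a b g f)
          (Normc.normc (log_branch alpha (toC (rlim f t)) -
                        log_branch alpha (toC (f t))))%:E < +oo)%E) :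
  exists phi psi : R -> scalar_field R k,
    (forall t : R, a <= t <= b -> f t = phi t * psi t) /\
    (AC_wrt a b g phi /\ AC_wrt a b (jump_part g) phi) /\
    (BC_wrt a b g psi /\ BC_usual a b psi) /\
    (forall t : R, a <= t <= b ->
       let D := `[a, t[ `&` common_jump_set a b g f in
       (exists2 S : R[i],
          has_sum D (fun s => log_branch alpha (toC (rlim f s)) -
                              log_branch alpha (toC (f s))) S &
          toC (phi t) = cexp S) /\
       has_prod D (fun s => 1 + jump f s / f s) (phi t) /\
       (exists2 S : scalar_field R k,
          has_sum D (fun s => jump f s / f s * phi s) S &
          phi t = 1 + S)).
Proof.
set D := common_jump_set a b g f.
pose L s := log_branch alpha (toC (rlim f s)) - log_branch alpha (toC (f s)).
have fin : (\esum_(s in D) (nc (L s))%:E < +oo)%E by [].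
pose c s := 1 + jump f s / f s.
have toC_neq0 x : x != 0 -> toC x != 0 :> R[i].
  by rewrite fmorph_eq0.
(* e^(L s) = f(s+) / f(s) = 1 + jump / f(s), since the exponential inverts every branch of the
   logarithm. *)
have cL s : D s -> toC (c s) = cexp (L s).
  move=> Ds; have [r0 f0] := logs_defined s Ds.
  rewrite /L cexpD cexpN !cexp_log_branch ?toC_neq0 // -fmorphV -rmorphM.
  by congr toC; rewrite /c /jump mulrBl divff // addrC subrK.
have ID s : `[a, s[ `&` D `<=` D by move=> r [].
have /choice[S hS] : forall t, exists l, has_sum (`[a, t[ `&` D) L l.
  by move=> t; exact: has_sum_exists (ID t) fin.
have prodS t e : 0 < e -> exists X0 : {fset R}, forall X : {fset R},
    (X0 `<=` X)%fset ->
    nc (cexp (S t) - toC (\prod_(s <- X | s \in `[a, t[ `&` D) c s)) < e.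
  exact: (cexp_has_sum_prod (ID t) fin (hS t) (fun s h => cL s h.2)).
(* For real [f] the logarithms may be complex, but e^(S t) is a limit of finite products of real
   ratios, hence real. *)
have /choice[phi phiS] :
    forall t, exists x : scalar_field R k, toC x = cexp (S t).
  move=> t; apply: toC_closed => e e0; have [X0 h0] := prodS t e e0.
  by eexists; exact: h0 (fsubset_refl _).
set M := fine (\esum_(s in D) (nc (L s))%:E).
have SM s : nc (S s) <= M := normc_has_sum_le (ID s) fin (hS s).
have phi0 t : phi t != 0.
  apply/eqP => p0; have := cexp_neq0 (S t); rewrite -phiS p0.
  by rewrite rmorph0 eqxx.
(* A uniform bound on 1 / phi = e^(-S), which makes [psi] bounded and [g]-continuous. *)
have phiV t : modulus (phi t)^-1 <= expR M.
  rewrite modulusV modulusE phiS -Normc.normcV -cexpN.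
  by apply: le_trans (normc_cexp_le _) _; rewrite ler_expR normcN.
have ACphi h : {homo h : x y / x <= y} ->
    (forall s x y, D s -> x <= s < y -> jump g s <= h y - h x) ->
    AC_wrt a b h phi.
  move=> hm; have Dg s : D s -> 0 < jump g s by case.
  exact (@AC_wrt_cexp R k a b D L S phi h (jump g) fin hS phiS hm Dg).
have ACg : AC_wrt a b g phi.
  by apply: ACphi => // s x y _; exact: jump_le.
have [/bounded_modulusP[N fN] gf] := f_BCg.
have {}fN t : a <= t <= b -> modulus (f t) <= N.
  by move=> tab; apply: fN; rewrite /= in_itv.
pose psi t := f t / phi t.
have psib : [bounded psi x | x in `[a, b]].
  apply/bounded_modulusP; exists (N * expR M) => t; rewrite /= in_itv /= => tab.
  by rewrite modulusM ler_pM ?modulus_ge0 ?fN.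
have psig : gcontinuous a b g psi.
  apply: gcontinuous_div fN phi0 phiV gf _.
  exact: AC_wrt_gcontinuous g_nondecreasing ACg.
have psic : {within `[a, b], continuous psi}.
  apply: within_continuous_left_right => t tab e e0.
    (* On the left, left continuity of [g] turns [g]-continuity of [psi] into ordinary
       continuity. *)
    have [d d0 hd] := psig t tab e e0.
    have /cvgrPdist_lt/(_ d d0) gl := g_left_continuous t.
    near=> s => as_; apply: hd.
      rewrite as_ /=; have : s <= t by near: s; exact: nbhs_left_le.
      by move=> /le_trans; apply; case/andP: tab.
    by near: s.
  (* On the right at a jump of [g], both [f] and [phi] are multiplied by the same factor [m], which
     cancels in the quotient. *)
  have [gt|ngt] := pselect (jump_set g t).
    have [at_ tb] := andP tab.
    have flim : f x @[x --> t^'+] --> rlim f t := f_right_limits t gt tab.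
    pose m := if t \in D then c t else 1.
    have mL : toC m = if t \in D then cexp (L t) else 1.
      by rewrite /m; case: ifPn => [/set_mem/cL//|_]; rewrite rmorph1.
    have plim := cexp_has_sum_right fin hS phiS at_ mL.
    have m0 : m != 0.
      apply/eqP => m0; move: mL; rewrite m0 rmorph0; case: ifP => _ /esym/eqP.
        by apply/negP; exact: cexp_neq0.
      by rewrite oner_eq0.
    have fm : rlim f t = f t * m.
      rewrite /m; case: ifPn => tD.
        have [_ f0] := logs_defined t (set_mem tD).
        by rewrite /c /jump mulrDr mulr1 mulrC divfK // addrC subrK.
      (* Off [D] the function [f] has no jump at [t]: a nonzero one would put [t] in [D]. *)
      apply/eqP; rewrite mulr1 -subr_eq0; apply: contraNT tD => j0.
      by apply/mem_set; split.
    have : psi x @[x --> t^'+] --> psi t.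
      have -> : psi t = rlim f t / (phi t * m).
        by rewrite /psi fm invfM mulrACA divff // mulr1.
      by apply: cvgM => //; apply: cvgV => //; rewrite mulf_neq0.
    by move=> /cvg_modulusP/(_ e e0); apply: filterS.
  (* Without a jump the monotone [g] is right continuous at [t], and the argument for the left side
     applies again. *)
  have grc : g x @[x --> t^'+] --> g t.
    have -> : g t = rlim g t.
      apply/eqP; rewrite eq_le rlim_ge //= -subr_le0 leNgt; exact/negP.
    exact: nondecreasing_rlim_cvg.
  have [at_ tb] := andP tab; have tab' : a <= t <= b by rewrite at_ ltW.
  have [d d0 hd] := psig t tab' e e0.
  have /cvgrPdist_lt/(_ d d0) {}grc := grc.
  near=> s => sb; apply: hd.
    rewrite sb andbT (le_trans at_) //; near: s; exact: nbhs_right_ge.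
  by near: s.
exists phi, psi; split; first by move=> t _; rewrite /psi mulrC divfK.
split; first split=> //.
  apply: ACphi; first exact: jump_part_nondecreasing.
  by move=> s x y [gs _]; exact: jump_part_jump_le.
split=> // t tab /=; split; first by exists (S t).
split.
  apply/has_prodP => e /(prodS t)[X0 h0]; exists X0 => X /h0.
  by rewrite modulusE rmorphB /= phiS.
(* The sum is computed in the complex numbers, where jump / f(s) = e^(L s) - 1 turns it into the sum
   of the jumps of e^S. *)
exists (phi t - 1); last by rewrite addrC subrK.
apply: has_sum_toC; rewrite rmorphB rmorph1 /= phiS.
apply: (eq_has_sum _ (@has_sum_cexp_jumps R a D L S fin hS t)).
move=> s /set_mem[_ Ds].
by rewrite rmorphM /= phiS -cL // /c rmorphD rmorph1 addrC addKr.
Unshelve. all: by end_near. Qed.
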